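(* Assume the Continuum Hypothesis. Then there is a crowded, zero-dimensional Hausdorff topological space $X$ which is $Nwd_\omega(X)$-selectively pseudocompact but not $Scat_\omega(X)$-selectively pseudocompact, where $Scat_\omega(X)$ is the family of countably infinite scattered subsets of $X$ and $Nwd_\omega(X)$ is the family of countably infinite nowhere dense subsets of $X$.
   Context: For a topological space $X$ and $\mathcal A\subseteq\mathcal P(X)$, $X$ is called $\mathcal A$-selectively pseudocompact if for every sequence $\langle U_n:n\in\omega\rangle$ of pairwise disjoint non-empty open subsets of $X$ one can choose sets $A_n\in\mathcal A$ with $A_n\subseteq U_n$ such that the family $\{A_n:n\in\omega\}$ has an accumulation point, i.e. there is a point $x\in X$ every neighbourhood of which meets $A_n$ for infinitely many $n$. A space is crowded if it has no isolated points. A set is scattered if each of its non-empty subsets has a point isolated in that subset. *)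

(* Defs.v *)
From HB Require Import structures.
From mathcomp Require Import all_boot all_order.
From mathcomp Require Import all_classical all_reals topology.
Set Implicit Arguments. Unset Strict Implicit. Unset Printing Implicit Defensive.
Local Open Scope classical_set_scope.
Local Open Scope card_scope.

Definition CH : Prop :=
  forall A : set (set nat), countable A \/ (A #= [set: set nat]).

Definition crowded (X : topologicalType) : Prop :=
  forall x : X, ~ isolated [set: X] x.

Definition zero_dim (X : topologicalType) : Prop :=
  forall (x : X) (U : set X), open U -> U x ->
    exists V : set X, [/\ clopen V, V x & V `<=` U].

Definition scattered_set (X : topologicalType) (S : set X) : Prop :=
  forall B : set X, B `<=` S -> B !=set0 -> exists x, isolated B x.

Definition nowhere_dense (X : topologicalType) (S : set X) : Prop :=
  interior (closure S) = set0.

Definition countably_infinite (T : Type) (S : set T) : Prop :=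
  countable S /\ infinite_set S.

Definition Scat_omega (X : topologicalType) : set (set X) :=
  [set S | countably_infinite S /\ scattered_set S].
Definition Nwd_omega (X : topologicalType) : set (set X) :=
  [set S | countably_infinite S /\ nowhere_dense S].

Definition acc_point_of_family (X : topologicalType) (A : nat -> set X) (x : X) :=
  forall U : set X, nbhs x U -> infinite_set [set n | A n `&` U !=set0].

Definition selectively_pseudocompact (X : topologicalType) (F : set (set X)) : Prop :=
  forall U : nat -> set X,
    (forall n, open (U n)) -> (forall n, U n !=set0) ->
    (forall m n, m <> n -> U m `&` U n = set0) ->
    exists A : nat -> set X,
      (forall n, F (A n) /\ A n `<=` U n) /\ exists x, acc_point_of_family A x.

(* Main.v *)
Require Import Defs.
From HB Require Import structures.
From mathcomp Require Import all_boot all_order.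
From mathcomp Require Import all_classical all_reals topology.
From mathcomp Require wochoice.
Set Implicit Arguments. Unset Strict Implicit. Unset Printing Implicit Defensive.
Local Open Scope classical_set_scope.
Local Open Scope card_scope.

(** Let I be a well-ordered set of size continuum whose proper initial segments are
    countable (CH), and let Y = Q x nat, where Q is the countable dense set of finite
    binary sequences, padded with zeros, in the Cantor space.  The space is
    X = Y + I, with the topology induced by the 0/1-valued coordinates nat + I.  On Y
    the coordinate i in nat reads the i-th bit of the first component, and the
    coordinates v_a (a in I) form a family which is independent on every column
    {q} x nat.  Hence the trace of a basic open set on a column is empty or infinite;
    it is nowhere dense, since a fresh bit leaves the column, and crowded.

    Every sequence of points of Y is listed at cofinally many a in I.  If (y_n) is
    listed at a, then the point a of X takes at the coordinates below a the limit of
    (y_n) along a fixed free ultrafilter.  Given open sets U_n, choose y_n in U_n and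
    let A_n be the trace on the column of y_n of a basic neighbourhood of y_n, with all
    the coordinates involved below a.  Independence of the later coordinates makes a an
    accumulation point of the sets A_n, whatever its values there.

    So v_a is free to separate a point x from a countable set S, also listed at a,
    provided S contains, up to finitely many points, no nonempty trace of a basic open
    set on a column; this is the case for countable scattered S because these traces
    are crowded.  Thus countable scattered sets are closed.  The union of scattered
    countable sets A_n contained in disjoint open sets is again scattered, so it is
    closed and the sets A_n do not accumulate. *)

(** * Enumerating and splitting infinite sets *)

Lemma countable_enum (T : Type) (t0 : T) (A : set T) :
  countable A -> exists h : nat -> T, A `<=` range h.
Proof.
move=> /countable_injP[f finj].
have /choice[h hP] : forall n, exists x, forall y, A y -> f y = n -> x = y.
  move=> n; have [[y [Ay fy]]|nex] := pselect (exists y, A y /\ f y = n).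
    exists y => z Az fz; apply: finj; rewrite ?inE //.
    by rewrite fy fz.
  by exists t0 => y Ay fy; case: nex; exists y.
by exists h => y Ay; exists (f y) => //; exact: hP.
Qed.

Lemma infinite_range_subset (T : Type) (A : set T) (g : nat -> T) :
  injective g -> (forall m, A (g m)) -> infinite_set A.
Proof.
move=> ginj Ag finA; apply: infinite_nat.
have -> : [set: nat] = g @^-1` A by apply/seteqP; split=> // m _; exact: Ag.
by apply: finite_preimage => // m n _ _ /ginj.
Qed.

(** Distinct points [t j] are chosen in turn, with [t j] in [J k] when [j] codes [(k, b, m)], and
    [w] takes the value [b] there; varying [m] gives infinitely many points for each [k] and [b]. *)
Lemma split_infinite (T : choiceType) (J : nat -> set T) :
  (forall k, infinite_set (J k)) ->
  exists w : T -> bool, forall k b, infinite_set (J k `&` [set y | w y = b]).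
Proof.
move=> Jinf.
have /choice[f fP] : forall ks : nat * seq T, exists t, J ks.1 t /\ t \notin ks.2.
  move=> [k s]; have : infinite_set (J k `\` [set` s]).
    by apply: infinite_setD => //; exact: finite_seq.
  by move=> /infinite_setN0[t [Jt /= /negP st]]; exists t.
pose dec (j : nat) : nat * bool * nat := odflt (0, true, 0) (unpickle j).
pose L := fix L j := if j is j'.+1 then f ((dec j').1.1, L j') :: L j' else [::].
pose t j := f ((dec j).1.1, L j).
have tL i j : i < j -> t i \in L j.
  elim: j => // j IH; rewrite ltnS leq_eqVlt => /orP[/eqP ->|/IH tij] /=.
    by rewrite inE eqxx.
  by rewrite inE tij orbT.
have tinj : injective t.
  suff tne i j : i < j -> t i != t j.
    move=> i j tij; case: (ltngtP i j) => // /tne; by rewrite tij eqxx.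
  move=> /tL ti; apply: contraTneq ti => ->.
  by have [_] := fP ((dec j).1.1, L j).
exists (fun y => `[< exists j, t j = y /\ (dec j).1.2 >]) => k b.
apply: (@infinite_range_subset _ _ (fun m => t (pickle (k, b, m)))).
  by move=> m n /tinj /(pcan_inj pickleK) [].
move=> m; have decE : dec (pickle (k, b, m)) = (k, b, m) by rewrite /dec pickleK.
split; first by rewrite /t decE; have [] := fP (k, L (pickle (k, b, m))).
case: b decE => decE /=; first by apply/asboolP; exists (pickle (k, true, m)); rewrite decE.
by apply/asboolP => -[j [/tinj -> ]]; rewrite decE.
Qed.

(** Infinite sets [J k] stay infinite without [S] and [x], so they can be split off these, where
    values are then prescribed. Finite [J k] are replaced by the whole type. *)
Lemma split_infinite_avoiding (T : choiceType) (J : nat -> set T) (S : set T) (x : T) :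
  infinite_set [set: T] ->
  (forall k, infinite_set (J k) -> infinite_set (J k `\` S)) ->
  exists w : T -> bool,
    [/\ forall k b, infinite_set (J k) -> infinite_set (J k `&` [set y | w y = b]),
        forall y, S y -> w y = false & ~ S x -> w x].
Proof.
move=> Tinf JS.
pose J' k := if `[< infinite_set (J k) >] then (J k `\` S) `\ x else setT.
have /split_infinite[w0 w0P] : forall k, infinite_set (J' k).
  rewrite /J' => k; case: asboolP => // Jk.
  by apply: infinite_setD; [exact: JS|exact: finite_set1].
exists (fun y => if `[< S y >] then false else if y == x then true else w0 y).
split=> [k b Jk|y Sy|nSx]; last 2 first.
- by rewrite asboolT.
- by rewrite asboolF // eqxx.
apply: sub_infinite_set (w0P k b); rewrite /J' asboolT // => y [[[Jy nSy] yx] wy].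
by split=> //=; rewrite asboolF //; move/eqP/negbTE: yx => ->.
Qed.

(** * Transfinite construction of an independent family *)

Section IndependentFamily.
Variables (I : eqType) (lt : I -> I -> Prop).
Hypothesis lt_wf : well_founded lt.
Hypothesis lt_total : forall a b, [\/ lt a b, a = b | lt b a].
Hypothesis lt_trans : forall a b c, lt a b -> lt b c -> lt a c.
Hypothesis lt_countable : forall a, countable [set b | lt b a].

Definition below (a : I) (l : seq (I * bool)) := forall p, p \in l -> lt p.1 a.

Definition pattern (T : Type) (v : I -> T -> bool) (l : seq (I * bool)) : set T :=
  [set y | forall p, p \in l -> v p.1 y = p.2].

(** The condition on [S] that lets [v a] vanish on [S] and still split every infinite pattern below
    [a]. *)
Definition good_at (T : Type) (D : nat -> set T) (v : I -> T -> bool) (a : I) (S : set T) :=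
  forall n l, below a l -> infinite_set (D n `&` pattern v l) ->
    infinite_set ((D n `&` pattern v l) `\` S).

Definition splits_at (T : Type) (D : nat -> set T) (v : I -> T -> bool) (a : I) (w : T -> bool) :=
  forall n l b, below a l -> infinite_set (D n `&` pattern v l) ->
    infinite_set ((D n `&` pattern v l) `&` [set y | w y = b]).

(** As [a] has countably many predecessors, only countably many patterns lie below it, and a single
    [w] splits them all. *)
Lemma extend_splitting (T : choiceType) (D : nat -> set T) (v : I -> T -> bool)
    (a : I) (S : set T) (x : T) :
  infinite_set [set: T] ->
  exists w, splits_at D v a w /\
    (good_at D v a S -> (forall y, S y -> w y = false) /\ (~ S x -> w x)).
Proof.
move=> Tinf; have [h hP] := countable_enum a (lt_countable a).
(* Filtering turns every list of coded pairs into a pattern below [a], and all such patterns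
   arise. *)
pose pat (l' : seq (nat * bool)) :=
  [seq p <- [seq (h q.1, q.2) | q <- l'] | `[< lt p.1 a >]].
have patb l' : below a (pat l').
  by move=> p; rewrite mem_filter => /andP[/asboolP].
have patP l : below a l -> exists l', pat l' = l.
  elim: l => [_|[b e] l IH bl]; first by exists [::].
  have [|l' l'E] := IH; first by move=> p pl; apply: bl; rewrite inE pl orbT.
  have ltba : lt b a by apply: (bl (b, e)); rewrite mem_head.
  have [n _ nE] := hP b ltba.
  by exists ((n, e) :: l'); rewrite /pat /= nE asboolT //; congr cons.
pose dec (j : nat) : nat * seq (nat * bool) := odflt (0, [::]) (unpickle j).
pose J j := D (dec j).1 `&` pattern v (pat (dec j).2).
have JP n l : below a l -> exists j, D n `&` pattern v l = J j.
  move=> /patP[l' <-]; exists (pickle (n, l')).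
  by rewrite /J /dec pickleK.
(* [S'] is empty when [S] is not good, so one application covers both cases. *)
pose S' := [set y | good_at D v a S /\ S y].
have [k Jk|w [wJ wS wx]] := @split_infinite_avoiding T J S' x Tinf.
  have [gS|ngS] := pselect (good_at D v a S).
    apply: sub_infinite_set (gS _ _ (patb _) Jk).
    by move=> y [Jy nSy]; split=> // -[].
  by apply: sub_infinite_set Jk => y Jy; split=> // -[].
exists w; split=> [n l b bl|gS].
  by have [j ->] := JP n l bl; exact: wJ.
by split=> [y Sy|nSx]; [exact: wS|apply: wx => -[]].
Qed.

(** Recursion along [lt]: the requirements on [v a] involve [v] only below [a], so the filler
    [false] elsewhere is harmless. *)
Lemma independent_family (T : choiceType) (D : nat -> set T) (S : I -> set T) (x : I -> T) :
  infinite_set [set: T] ->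
  exists v : I -> T -> bool, forall a, splits_at D v a (v a) /\
    (good_at D v a (S a) ->
      (forall y, S a y -> v a y = false) /\ (~ S a (x a) -> v a (x a))).
Proof.
move=> Tinf.
have /choice[F FP] : forall av : I * (I -> T -> bool), exists w,
    splits_at D av.2 av.1 w /\ (good_at D av.2 av.1 (S av.1) ->
    (forall y, S av.1 y -> w y = false) /\ (~ S av.1 (x av.1) -> w (x av.1))).
  by move=> [a v]; exact: extend_splitting.
pose restr a (r : forall b, lt b a -> T -> bool) b y :=
  if pselect (lt b a) is left H then r b H y else false.
pose v := Fix lt_wf (fun=> T -> bool) (fun a r => F (a, restr a r)).
have vE a : v a = F (a, fun b y => if pselect (lt b a) then v b y else false).
  rewrite /v Fix_eq //; last first.
    move=> b f g fg; congr (F (b, _)); apply/funext => c; apply/funext => y.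
    by rewrite /restr; case: pselect => // H; rewrite fg.
  congr (F (a, _)); apply/funext => b; apply/funext => y.
  by rewrite /restr; case: pselect.
exists v => a; have := FP (a, fun b y => if pselect (lt b a) then v b y else false).
rewrite -vE /=; set g := (fun b y => _).
have pE l : below a l -> pattern g l = pattern v l.
  move=> bl; apply/seteqP; split=> y yl p pl; move: (yl p pl); rewrite /g;
  by case: pselect => // -[]; exact: bl.
move=> [sp gd]; split=> [n l b bl|gS].
  by rewrite -pE //; exact: sp.
by apply: gd => n l bl; rewrite pE //; exact: gS.
Qed.

Lemma seq_max (F : seq I) : F != [::] ->
  exists2 a, a \in F & forall b, b \in F -> b = a \/ lt b a.
Proof.
elim: F => // c F IH _; have [->|/IH[a aF aP]] := eqVneq F [::].
  by exists c; rewrite ?mem_head // => b; rewrite inE => /eqP; left.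
case: (lt_total c a) => [ca|ca|ac].
- exists a; rewrite ?inE ?aF ?orbT // => b.
  by rewrite inE => /orP[/eqP ->|/aP]; [right|].
- exists a; rewrite ?inE ?aF ?orbT // => b.
  by rewrite inE => /orP[/eqP ->|/aP]; [left|].
- exists c; rewrite ?mem_head // => b.
  rewrite inE => /orP[/eqP ->|/aP[->|ba]]; [by left|by right|right].
  exact: lt_trans ba ac.
Qed.

(** Induction on the number of coordinates: the largest one splits the pattern given by the others,
    which lie below it. *)
Lemma independent_pattern (T : Type) (D : nat -> set T) (v : I -> T -> bool)
    (n : nat) (F : seq I) (e : I -> bool) :
  (forall a, splits_at D v a (v a)) -> infinite_set (D n) ->
  infinite_set (D n `&` [set y | forall a, a \in F -> v a y = e a]).
Proof.
move=> sp Dn; have [k] := ubnP (size F); elim: k F => // k IH F sF.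
have [->|/seq_max[a aF aP]] := eqVneq F [::].
  by apply: sub_infinite_set Dn => y Dy; split.
pose F' := [seq b <- F | b != a].
have sF' : size F' < k.
  apply: leq_trans (_ : size F <= k) => //; rewrite size_filter -(count_predC (pred1 a)).
  by rewrite -[X in X < _]add0n ltn_add2r -has_count has_pred1.
pose l := [seq (b, e b) | b <- F'].
have bl : below a l.
  move=> p /mapP[b + ->]; rewrite mem_filter => /andP[ba /aP[bE|//]] /=.
  by rewrite bE eqxx in ba.
have pE : pattern v l = [set y | forall b, b \in F' -> v b y = e b].
  apply/seteqP; split=> y yl /=.
    by move=> b bF; apply: (yl (b, e b)); apply/mapP; exists b.
  by move=> p /mapP[b bF ->]; exact: yl.
have := sp a n l (e a) bl; rewrite pE => /(_ (IH _ sF')).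
apply: sub_infinite_set => y [[Dy yF'] ya]; split=> // b bF.
by have [->//|ba] := eqVneq b a; apply: yF'; rewrite mem_filter ba.
Qed.

End IndependentFamily.

(** * A well-order of the continuum with countable initial segments *)

Lemma CH_well_order : CH ->
  exists (I : eqType) (lt : I -> I -> Prop),
    [/\ well_founded lt, forall a b, [\/ lt a b, a = b | lt b a],
        forall a b c, lt a b -> lt b c -> lt a c,
        forall a, countable [set b | lt b a] &
        exists f : I -> set nat, bijective f].
Proof.
move=> ch; pose T : eqType := set nat.
have [R Rwo] := wochoice.well_ordering_principle T.
have Rmin (P : set T) : P !=set0 -> exists z, [/\ P z, forall x, P x -> R z x &
    forall z', P z' -> (forall x, P x -> R z' x) -> z = z'].
  move=> [a Pa]; have [|z [[Pz zmin] zuniq]] := Rwo [pred x | `[< P x >]].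
    by exists a; apply/asboolP.
  exists z; split=> [|x Px|z' Pz' z'min].
  - exact/asboolP.
  - by apply: zmin; apply/asboolP.
  - by apply: zuniq; split=> [|x /asboolP/z'min //]; apply/asboolP.
(* Least elements of sets of one, two and three points give reflexivity, antisymmetry and
   transitivity of the strict order. *)
have Rrefl a : R a a.
  by have [|_ [-> + _]] := Rmin [set a]; [exists a|apply].
have Ranti a b : R a b -> R b a -> a = b.
  move=> ab ba; have [|z [_ _ zuniq]] := Rmin [set a; b]; first by exists a; left.
  have <- : z = a by apply: zuniq => [|x [] ->]; [left|..].
  by apply: zuniq => [|x [] ->]; [right|..].
pose lt (a b : T) := ~~ R b a.
have lttot a b : [\/ lt a b, a = b | lt b a].
  case: (boolP (R a b)) => ab; last by apply: Or33.
  case: (boolP (R b a)) => ba; last by apply: Or31.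
  by apply: Or32; apply: Ranti.
have lttrans a b c : lt a b -> lt b c -> lt a c.
  move=> ab bc; apply/negP => ca.
  have [|z [zabc zmin _]] := Rmin [set x | [\/ x = a, x = b | x = c]].
    by exists a; apply: Or31.
  have za : R z a by apply: zmin; apply: Or31.
  have zb : R z b by apply: zmin; apply: Or32.
  have zc : R z c by apply: zmin; apply: Or33.
  case: zabc => zE; subst z.
  - have ac : a = c by apply: Ranti.
    by subst c; move: bc; rewrite /lt zb.
  - by move: ab; rewrite /lt za.
  - by move: bc; rewrite /lt zb.
have ltwf : well_founded lt.
  move=> a; apply: contrapT => na.
  have [|z [zP zmin _]] := Rmin [set x | ~ Acc lt x]; first by exists a.
  apply: zP; split=> b bz; apply: contrapT => nb.
  by move: bz; rewrite /lt zmin.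
(* [J] is the whole order, or its least uncountable initial segment. *)
have [J Jctbl Jcard] : exists2 J : pred T,
    forall a, J a -> countable [set b | lt b a] &
    [set` J] #= [set: set nat].
  have [allc|] := pselect (forall a, countable [set b | lt b a]).
    exists xpredT => //.
    by rewrite (_ : [set` _] = setT) ?card_eqxx //; apply/seteqP; split.
  move=> /existsNP[a0 a0unc].
  have [|z [zunc zmin _]] := Rmin [set x | ~ countable [set b | lt b x]].
    by exists a0.
  exists (fun b => `[< lt b z >]).
  - move=> a /asboolP az; apply: contrapT => nc.
    by move: az; rewrite /lt zmin.
  - rewrite (_ : [set` _] = [set b | lt b z]).
      by have [] := ch [set b | lt b z].
    by apply/seteqP; split=> b /= /asboolP.
pose I : eqType := {x : T | J x}.
exists I, (fun a b => lt (val a) (val b)); split.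
- suff wfI x : Acc lt x -> forall a : I, val a = x -> Acc (fun a b : I => lt (val a) (val b)) a.
    by move=> a; exact: wfI (ltwf (val a)) a erefl.
  by elim=> {}x _ IH a aE; split=> b ba; apply: (IH (val b)) => //; rewrite -aE.
- move=> a b; case: (lttot (val a) (val b)) => [ab|/val_inj|ba].
  + exact: Or31.
  + exact: Or32.
  + exact: Or33.
- by move=> a b c; exact: lttrans.
- move=> a; have /countable_injP[f finj] := Jctbl _ (valP a).
  apply/countable_injP; exists (f \o val) => b c; rewrite !inE => ba ca /= fE.
  by apply/val_inj/finj; rewrite ?inE.
- have /card_set_bijP[f [_ finj fsurj]] := Jcard.
  have /choice[g gP] : forall A, exists a : I, f (val a) = A.
    by move=> A; have [x Jx fx] := fsurj A Logic.I; exists (exist _ x Jx).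
  exists (f \o val); exists g => [a|//]; apply/val_inj/finj; rewrite ?gP ?inE //.
  - exact: (valP (g _)).
  - exact: (valP a).
Qed.

(** * Coding by sets of natural numbers *)

Definition continuum_bounded (T : Type) := exists g : set nat -> T, forall t, exists A, g A = t.

Lemma continuum_bounded_countType (T : countType) : T -> continuum_bounded T.
Proof.
move=> t0; exists (fun A => odflt t0 (unpickle (xget 0 A))) => t.
exists [set pickle t]; have -> : xget 0 [set pickle t] = pickle t.
  by apply: (@xgetPex _ 0 [set pickle t]); exists (pickle t).
by rewrite pickleK.
Qed.

Lemma continuum_bounded_sum (T U : Type) :
  continuum_bounded T -> continuum_bounded U -> continuum_bounded (T + U).
Proof.
move=> [f fP] [g gP].
exists (fun A => if `[< A 0 >] then inl (f [set n | A n.+1]) else inr (g [set n | A n.+1])).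
case=> [t|u].
  by have [A <-] := fP t; exists [set n | if n is m.+1 then A m else True]; rewrite asboolT.
by have [A <-] := gP u; exists [set n | if n is m.+1 then A m else False]; rewrite asboolF.
Qed.

Lemma continuum_bounded_prod (T U : Type) :
  continuum_bounded T -> continuum_bounded U -> continuum_bounded (T * U).
Proof.
move=> [f fP] [g gP].
exists (fun A => (f [set n | A (n.*2)], g [set n | A (n.*2.+1)])) => -[t u].
have [[A <-] [B <-]] := (fP t, gP u).
exists [set n | if odd n then B n./2 else A n./2]; congr (f _, g _);
  by apply/funext => n /=; rewrite odd_double ?doubleK //= uphalf_double.
Qed.

Lemma continuum_bounded_seq (T : Type) :
  continuum_bounded T -> continuum_bounded (nat -> T).
Proof.
move=> [f fP]; exists (fun A n => f [set m | A (pickle (n, m))]) => s.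
have /choice[B BP] := fun n => fP (s n).
exists [set k | if unpickle k is Some (n, m) then B n m else False].
apply/funext => n; rewrite -(BP n); congr f.
by apply/funext => m; rewrite /= pickleK.
Qed.

(* The fibers of [code] are uncountable, by Cantor's diagonal argument. *)
Lemma cofinal_coding (I : Type) (lt : I -> I -> Prop) (C : Type) :
  (forall a b, [\/ lt a b, a = b | lt b a]) ->
  (forall a, countable [set b | lt b a]) ->
  (exists f : I -> set nat, bijective f) ->
  continuum_bounded C ->
  exists code : I -> C, forall c (B : set I), countable B ->
    exists a, code a = c /\ forall b, B b -> lt b a.
Proof.
move=> lttot ltctbl [f [f' _ fK]] [g gsurj].
exists (fun a => g [set n | f a n.*2]) => c B Bctbl.
have [h hP] : exists h : nat -> I, \bigcup_(b in B) (b |` [set a | lt a b]) `<=` range h.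
  apply: (countable_enum (f' set0)).
  apply: bigcup_countable => // b _.
  by rewrite -bigcup2E; apply: bigcup_countable => // -[|[|n]] _ //=; exact: countable1.
have [A gA] := gsurj c.
(* The even digits of [D] carry the code of [c]; the digit [2k+1] differs from that of [h k], so [a]
   avoids the range of [h]. *)
pose D := [set n | if odd n then ~ f (h n./2) n else A n./2].
pose a := f' D; have fa : f a = D by exact: fK.
exists a; split.
  rewrite -gA; congr g; apply/funext => n; rewrite fa /D /=.
  by rewrite odd_double doubleK.
move=> b Bb; have ba : ~ (b |` [set a | lt a b]) a.
  move=> ab; have [n _ hn] : range h a by apply: hP; exists b.
  have /(congr1 (@^~ n.*2.+1)) := fa.
  rewrite /D /= odd_double uphalf_double hn /= => E.
  have N : ~ f a n.*2.+1 by move=> F; move: (F); rewrite E; exact.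
  by apply: (N); rewrite E.
by case: (lttot a b) => // [ab|ab]; case: ba; [right|left].
Qed.

(** * The topology induced by two-valued coordinates *)

Definition coord_space (X K : Type) (c : K -> X -> bool) : Type := X.

Section CoordSpace.
Variables (X : Type) (K : eqType) (c : K -> X -> bool).

Definition agree (x : X) (l : seq K) : set X := [set z | forall k, k \in l -> c k z = c k x].

(** The initial topology for the coordinates. Since [c] is a parameter of [coord_space], each family
    of coordinates gets its own topology. *)
Definition coord_open : set (set X) :=
  [set U | forall x, U x -> exists l, agree x l `<=` U].

Lemma coord_openT : coord_open setT.
Proof. by move=> x _; exists [::]. Qed.

Lemma coord_openI : setI_closed coord_open.
Proof.
move=> U V Uo Vo x [/Uo[l lU] /Vo[m mV]]; exists (l ++ m) => z zlm; split.
  by apply: lU => k kl; apply: zlm; rewrite mem_cat kl.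
by apply: mV => k km; apply: zlm; rewrite mem_cat km orbT.
Qed.

Lemma coord_open_bigcup (J : Type) (f : J -> set X) :
  (forall i, coord_open (f i)) -> coord_open (\bigcup_i f i).
Proof.
move=> fo x [i _ /fo[l lf]]; exists l => z /lf fz.
by exists i.
Qed.

HB.instance Definition _ := gen_eqMixin (coord_space c).
HB.instance Definition _ := gen_choiceMixin (coord_space c).
HB.instance Definition _ :=
  isOpenTopological.Build (coord_space c) coord_openT coord_openI coord_open_bigcup.

Local Notation CX := (coord_space c : topologicalType).

Lemma agree_refl (x : X) l : agree x l x.
Proof. by []. Qed.

Lemma openP (U : set CX) : open U <-> coord_open U.
Proof. by []. Qed.

Lemma open_agree (x : CX) l : open (agree x l : set CX).
Proof. by apply/openP => y yl; exists l => z zl k kl; rewrite zl // yl. Qed.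

Lemma open_agreeP (U : set CX) (x : CX) : open U -> U x -> exists l, agree x l `<=` U.
Proof. by move=> /openP/[apply]. Qed.

Lemma nbhs_agree (U : set CX) (x : CX) : nbhs x U -> exists l, agree x l `<=` U.
Proof. by rewrite nbhsE => -[V [Vo /(open_agreeP Vo)[l lV]] VU]; exists l => z /lV /VU. Qed.

Lemma agree_nbhs (x : CX) l : nbhs x (agree x l : set CX).
Proof. by apply: open_nbhs_nbhs; split; [exact: open_agree|exact: agree_refl]. Qed.

Lemma coord_space_zero_dim : zero_dim CX.
Proof.
move=> x U Uo /(open_agreeP Uo)[l lU]; exists (agree x l); split=> //.
split; first exact: open_agree.
rewrite -openC; apply/openP => y ny; exists l => z zl zx; apply: ny => k kl.
by rewrite -zl // zx.
Qed.

Lemma coord_space_hausdorff :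
  (forall x y, x <> y -> exists k, c k x <> c k y) -> hausdorff_space CX.
Proof.
move=> sep x y xy; apply: contrapT => /sep[k]; apply.
have [z [zx zy]] := xy _ _ (agree_nbhs x [:: k]) (agree_nbhs y [:: k]).
by rewrite -(zx k) ?mem_head // (zy k) ?mem_head.
Qed.

End CoordSpace.

(** * The space and its separation properties *)

Section Space.
Variables (I : eqType) (lt : I -> I -> Prop).
Hypothesis lt_total : forall a b, [\/ lt a b, a = b | lt b a].
Hypothesis lt_irr : forall a, ~ lt a a.
Hypothesis lt_trans : forall a b c, lt a b -> lt b c -> lt a c.

Local Notation Y := (seq bool * nat)%type.
Local Notation X := (Y + I)%type.
Local Notation K := (nat + I)%type.

Definition column (n : nat) : set Y := [set y | pickle y.1 = n].

Variable v : I -> Y -> bool.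
Hypothesis v_splits : forall a, splits_at lt column v a (v a).

Definition base_coord (k : K) (y : Y) : bool :=
  match k with inl i => nth false y.1 i | inr a => v a y end.

Lemma infinite_column (q : seq bool) : infinite_set (column (pickle q)).
Proof. by apply: (@infinite_range_subset _ _ (pair q)) => // m n []. Qed.

(** The bits of [q] settle the coordinates in [nat] on the whole column; independence on that column
    settles those in [I]. *)
Lemma infinite_cell (l : seq K) (e : K -> bool) (q : seq bool) :
  (forall i, inl i \in l -> nth false q i = e (inl i)) ->
  infinite_set [set y : Y | y.1 = q /\ forall k, k \in l -> base_coord k y = e k].
Proof.
move=> eq; pose F := pmap (fun k : K => if k is inr a then Some a else None) l.
have := @independent_pattern _ _ lt_total lt_trans _ _ _ _ F (e \o inr) v_splits (@infinite_column q).
apply: sub_infinite_set => y [/(pcan_inj pickleK) yq yF]; split=> // -[i|a] kl /=.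
  by rewrite yq eq.
by apply: yF; rewrite mem_pmap; apply/mapP; exists (inr a).
Qed.

Lemma finite_inl (x : X) : finite_set [set y : Y | inl y = x].
Proof.
case: x => [y|a]; first by apply: sub_finite_set (finite_set1 y) => z [->].
by apply: sub_finite_set (finite_set0 Y) => z.
Qed.

Lemma realize_bits (l : seq K) (e : K -> bool) :
  exists q, forall i, inl i \in l -> nth false q i = e (inl i).
Proof.
pose N := \max_(k <- l) (if k is inl i then i else 0).
exists (mkseq (fun i => e (inl i)) N.+1) => i il.
by rewrite nth_mkseq // ltnS; apply: (leq_bigmax_seq (inl i)).
Qed.

(** [(code a).1] is the sequence whose limit the point [a] becomes; [(code a).2] is a sequence and a
    point that the coordinate [a] should separate. *)
Variable code : I -> (nat -> Y) * ((nat -> X) * X).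
Hypothesis code_cofinal : forall c (B : set I), countable B ->
  exists a, code a = c /\ forall b, B b -> lt b a.
Hypothesis v_separates : forall a,
  good_at lt column v a [set y | exists n, (code a).2.1 n = inl y] ->
  (forall y, (exists n, (code a).2.1 n = inl y) -> v a y = false) /\
  (forall y, (code a).2.2 = inl y -> ~ (exists n, (code a).2.1 n = inl y) -> v a y).

Variable F : set_system nat.
Hypothesis F_ultra : UltraFilter F.
Hypothesis F_free : forall A, F A -> infinite_set A.

Definition ulim (b : nat -> bool) : bool := `[< F [set n | b n] >].

Lemma ulimP (b : nat -> bool) : F [set n | b n = ulim b].
Proof.
rewrite /ulim; case: asboolP => // nFb.
have [//|] := in_ultra_setVsetC [set n | b n] F_ultra.
by apply: filterS => n /= /negP/negbTE.
Qed.

Lemma ulim_seq (K' : eqType) (b : K' -> nat -> bool) (l : seq K') :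
  F [set n | forall k, k \in l -> b k n = ulim (b k)].
Proof.
elim: l => [|k l IH]; first by apply: filterS filterT.
apply: filterS (filterI (ulimP (b k)) IH) => n [bk bl] k'.
by rewrite inE => /orP[/eqP ->|/bl].
Qed.

Definition low (a : I) (k : K) : Prop := if k is inr b then lt b a else True.

(* Below [a], the point [inr a] is the limit along [F] of the coded sequence of
   points of [Y]; each later coordinate [b] only has to put it on the right side of
   the separation coded by [b]. *)
Definition coord (k : K) (z : X) : bool :=
  match z with
  | inl y => base_coord k y
  | inr a =>
    if `[< low a k >] then ulim (fun n => base_coord k ((code a).1 n))
    else if k is inr b then `[< forall n, (code b).2.1 n <> inr a >] else true
  end.

Local Notation CX := (coord_space coord : topologicalType).

Lemma countable_indices (s : nat -> seq K) :
  countable [set b | exists n, inr b \in s n].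
Proof.
pose A n : set I := [set b | inr b \in s n].
have -> : [set b | exists n, inr b \in s n] = \bigcup_n A n.
  by apply/seteqP; split=> b [n]; [exists n|move=> _ bn; exists n].
apply: bigcup_countable => // n _; apply: finite_set_countable.
rewrite (_ : A n = inr @^-1` [set` s n]); last by [].
by apply: finite_preimage; [move=> b c _ _ []|exact: finite_seq].
Qed.

(** [(s, x)] is coded at some [b] above all points of [I] among [x] and the [s n]; at these,
    coordinate [b] records whether they differ from every [s n], while [v_separates] handles points
    of [Y]. *)
Lemma separate (s : nat -> X) (x : X) :
  (forall n, s n <> x) ->
  (forall n l, infinite_set (column n `&` pattern v l) ->
     infinite_set ((column n `&` pattern v l) `\` [set y | exists n, s n = inl y])) ->
  exists b, coord (inr b) x /\ forall n, coord (inr b) (s n) = false.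
Proof.
move=> sx good; pose idx (z : X) : seq K := if z is inr b then [:: inr b] else [::].
have [b [cb bB]] := code_cofinal ((fun=> ([::], 0)), (s, x))
  (countable_indices (fun n => if n is m.+1 then idx (s m) else idx x)).
have nlow a : lt a b -> ~ low a (inr b) by move=> ab ba; apply: (lt_irr (lt_trans ab ba)).
have [|vs vx] := @v_separates b.
  by rewrite cb => n l _; exact: good.
exists b; split.
  case: x sx cb bB vx => [y|a] sx cb bB vx /=.
    by apply: vx; rewrite cb // => -[n /sx].
  rewrite asboolF; last by apply: nlow; apply: bB; exists 0; rewrite mem_head.
  by apply/asboolP; rewrite cb.
move=> n; case E : (s n) => [y|a] /=.
  by apply: vs; rewrite cb; exists n.
rewrite asboolF; last by apply: nlow; apply: bB; exists n.+1; rewrite E mem_head.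
by apply/asboolP; rewrite cb => /(_ n).
Qed.

Lemma space_crowded : crowded CX.
Proof.
move=> x [_ [V nV VE]]; have [l lV] := nbhs_agree nV.
have [q qP] := realize_bits l (coord^~ x).
have := @infinite_cell l (coord^~ x) q qP; apply.
apply: sub_finite_set (finite_inl x) => y [_ yl].
have : (V `&` setT) (inl y) by split=> //; exact: lV.
by rewrite VE.
Qed.

(** The case of a constant sequence in [separate]: removing one point leaves infinite traces
    infinite. *)
Lemma space_hausdorff : hausdorff_space CX.
Proof.
apply: coord_space_hausdorff => x y xy.
have [|n l ninf|b [bx bs]] := @separate (fun=> y) x.
- by move=> _ yx; apply: xy.
- apply: infinite_setD => //.
  by apply: sub_finite_set (finite_inl y) => z [_ /esym].
- by exists (inr b); rewrite bx (bs 0).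
Qed.

(** * Cells: nowhere density and accumulation *)

Definition cell (y : Y) (l : seq K) : set X :=
  inl @` [set y' : Y | y'.1 = y.1 /\ forall k, k \in l -> base_coord k y' = base_coord k y].

Lemma cell_Nwd y l : @Nwd_omega CX (cell y l).
Proof.
split; first split.
- exact: sub_countable (card_image_le _ _) _.
- move=> fin; have : infinite_set (inl @^-1` (cell y l)).
    apply: sub_infinite_set (@infinite_cell l (base_coord^~ y) y.1 _) => //.
    by move=> y' yl; exists y'.
  by apply; apply: finite_preimage fin => ? ? _ _ [].
apply/seteqP; split=> // z; rewrite /interior /= => nz; have [m mcl] := nbhs_agree nz.
have [i im] : exists i, inl i \notin m.
  pose N := \max_(k <- m) (if k is inl i then i else 0).
  exists N.+1; apply/negP => Nm.
  have : N.+1 <= N by apply: (leq_bigmax_seq (inl N.+1)).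
  by rewrite ltnn.
(* The bit [i] is not restricted by [m], so it can be flipped against the column of [y]: the
   resulting [y1] is near [z] but has a neighbourhood missing the cell. *)
pose e k := if k == inl i then ~~ nth false y.1 i else coord k z.
have [q qP] := realize_bits (inl i :: m) e.
have [y1 [_ y1P]] := infinite_setN0 (@infinite_cell _ e q qP).
have /mcl y1cl : agree coord z m (inl y1).
  move=> k km; rewrite -[LHS]/(base_coord k y1) y1P ?inE ?km ?orbT // /e.
  by have [ki|//] := eqVneq k (inl i); rewrite -ki km in im.
have [_ [[y0 [y0q _] <-] /(_ (inl i))]] := y1cl _ (agree_nbhs (inl y1 : CX) [:: inl i]).
rewrite mem_head => /(_ isT); rewrite -[RHS]/(base_coord (inl i) y1) y1P ?mem_head // /e eqxx /= y0q.
by case: nth.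
Qed.

Lemma cell_accumulation (y : nat -> Y) (l : nat -> seq K) :
  exists x, @acc_point_of_family CX (fun n => cell (y n) (l n)) x.
Proof.
(* [a] lies above every index in [I] occurring in the lists [l n]; the separation half of the code
   is filler. *)
have [a [ca aB]] := code_cofinal (y, ((fun=> inl ([::], 0)), inl ([::], 0)))
  (countable_indices l).
exists (inr a) => U nU; have [m mU] := nbhs_agree nU.
(* [e n] copies [y n] at low coordinates, which keeps the point in the [n]-th cell, and [inr a] at
   the others. For a set of [n] in [F], the low coordinates in [m] agree with [inr a] too. *)
pose e n k := if `[< low a k >] then base_coord k (y n) else coord k (inr a).
have lowE n : [set n | forall k, k \in m -> base_coord k (y n) = ulim (fun n => base_coord k (y n))] n ->
  forall k, k \in m -> e n k = coord k (inr a).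
  by move=> yn k km; rewrite /e /= ca /=; case: asboolP => // _; exact: yn.
have Finf := F_free (ulim_seq (fun k n => base_coord k (y n)) m).
apply: sub_infinite_set Finf => n yn.
have [|y' [y'q y'l]] := infinite_setN0 (@infinite_cell (l n ++ m) (e n) (y n).1 _).
  by move=> i _; rewrite /e asboolT.
exists (inl y'); split.
  exists y' => //; split=> // k kl; rewrite y'l ?mem_cat ?kl // /e asboolT //.
  by case: k kl => // b bl; apply: aB; exists n.
by apply: mU => k km; rewrite -(lowE n yn k km) -y'l // mem_cat km orbT.
Qed.

Lemma space_Nwd : @selectively_pseudocompact CX (@Nwd_omega CX).
Proof.
move=> U Uo U0 _.
have /choice[yl ylU] : forall n, exists yl, cell yl.1 yl.2 `<=` U n.
  move=> n; have [x Ux] := U0 n; have [l lU] := open_agreeP (Uo n) Ux.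
  have [q qP] := realize_bits l (coord^~ x).
  have [y [_ yl]] := infinite_setN0 (@infinite_cell l (coord^~ x) q qP).
  exists (y, l) => _ [y' [_ y'l] <-]; apply: lU => k kl.
  by rewrite -yl // -y'l.
exists (fun n => cell (yl n).1 (yl n).2); split=> [n|].
  by split=> //; exact: cell_Nwd.
exact: cell_accumulation.
Qed.

(** * Failure for scattered sets *)

Definition first_bit (n : nat) : set X :=
  [set z | coord (inl n) z /\ forall i, i < n -> coord (inl i) z = false].

Definition bits (n : nat) : seq K := [seq inl i | i <- iota 0 n.+1].

Lemma first_bit_agree n x : first_bit n x -> agree coord x (bits n) `<=` first_bit n.
Proof.
move=> [xn xi] z zn; split=> [|i ni].
  by rewrite zn // map_f // mem_iota ltnS leqnn.
by rewrite zn ?xi // map_f // mem_iota ltnS (ltnW ni).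
Qed.

Lemma first_bit_disjoint m n z : first_bit m z -> first_bit n z -> m = n.
Proof.
move=> [zm mz] [zn nz]; case: (ltngtP m n) => // mn.
  by rewrite nz in zm.
by rewrite mz in zn.
Qed.

Lemma space_not_Scat : ~ @selectively_pseudocompact CX (@Scat_omega CX).
Proof.
move=> /(_ first_bit)[n|n|m n mn|A [AU [x xacc]]].
- by apply/openP => x xn; exists (bits n); exact: first_bit_agree.
- exists (inl (ncons n false [:: true], 0)); split=> [|i ni] /=.
    by rewrite nth_ncons ltnn subnn.
  by rewrite nth_ncons ni.
- by apply/seteqP; split=> // z [zm zn]; apply: mn; exact: first_bit_disjoint zm zn.
(* Otherwise [first_bit n] is a neighbourhood of [x] that meets no other [A m]. *)
have notin n : ~ A n x.
  move=> Anx; have xn : first_bit n x by have [_] := AU n; exact.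
  have : nbhs (x : CX) (agree coord x (bits n) : set CX) by exact: agree_nbhs.
  move=> /xacc; apply; apply: sub_finite_set (finite_set1 n) => m [z [Amz /(first_bit_agree xn) zn]].
  by apply: first_bit_disjoint zn; have [_] := AU m; exact.
pose S := \bigcup_n A n.
have Sctbl : countable S by apply: bigcup_countable => // n _; have [[[]]] := AU n.
have [s sP] := countable_enum x Sctbl.
have [z0 Sz0] : S !=set0.
  by have [[[_ /infinite_setN0[z A0z]] _] _] := AU 0; exists z; exists 0.
(* Values of [s] outside [S] are replaced by [z0], so [s'] enumerates exactly [S]. *)
pose s' n := if `[< S (s n) >] then s n else z0.
have s'S n : S (s' n) by rewrite /s'; case: asboolP.
have Ss' z : S z -> exists n, s' n = z.
  by move=> Sz; have [n _ nz] := sP z Sz; exists n; rewrite /s' nz asboolT.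
have [n nx|n l ninf nfin|b [bx bs]] := @separate s' x.
- by have [m _] := s'S n; rewrite nx => /notin.
(* If [S] contained [C] up to finitely many points, some [A m] would meet [C]; [t] is then an
   isolated point of that intersection. *)
- pose C := column n `&` pattern v l.
  have [y0 Cy0 Sy0] : exists2 y, C y & S (inl y).
    apply: contrapT => nex; apply: ninf; apply: sub_finite_set nfin => y Cy; split=> // -[k sk].
    by apply: nex; exists y => //; rewrite -sk.
  have [m _ Amy0] := Sy0; have [[_ Am_scat] Am_bit] := AU m.
  have [t [tB [V nV VB]]] : exists t, isolated (A m `&` inl @` C : set CX) t.
    by apply: Am_scat; [move=> z []|exists (inl y0); split=> //; exists y0].
  have [Amt [y1 [y1n y1l] y1t]] := set_mem tB; have [l' l'V] := nbhs_agree nV.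
  (* These coordinates keep an infinite cell around [t] inside [V], [first_bit m] and [C]. All but
     finitely many of its points lie in [S], hence in [A m], hence equal [t]. *)
  have := @infinite_cell (l' ++ bits m ++ [seq inr p.1 | p <- l]) (base_coord^~ y1) y1.1.
  move=> /(_ (fun _ _ => erefl)); apply.
  apply: (@sub_finite_set _ _ ((C `\` [set y | exists n, s' n = inl y]) `|` [set y | inl y = t])).
    move=> y [yn yl]; have Cy : C y.
      split=> [|p pl]; first by rewrite /column /= yn.
      rewrite -y1l //; apply: (yl (inr p.1)).
      by rewrite !mem_cat (map_f (fun p => inr p.1)) ?orbT.
    have [[k _ Aky]|nSy] := pselect (S (inl y)); last first.
      by left; split=> // -[k sk]; apply: nSy; rewrite -sk.
    right; have km : k = m.
      apply: (@first_bit_disjoint _ _ (inl y)); first by have [_] := AU k; exact.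
      apply: (first_bit_agree (Am_bit _ Amt)) => j jm; rewrite -y1t.
      by apply: (yl j); rewrite !mem_cat jm orbT.
    have : (V `&` (A m `&` inl @` C)) (inl y).
      split; last by split; [rewrite -km|exists y].
      by apply: l'V => j jl'; rewrite -y1t; apply: (yl j); rewrite mem_cat jl'.
    by rewrite VB.
  by rewrite finite_setU; split=> //; exact: finite_inl.
(* The neighbourhood on which coordinate [b] is true misses every [A n]. *)
- have /xacc : nbhs (x : CX) (agree coord x [:: inr b] : set CX) by exact: agree_nbhs.
  apply; apply: sub_finite_set (finite_set0 nat) => n [z [Anz /(_ (inr b))]].
  have [m <-] : exists m, s' m = z by apply: Ss'; exists n.
  by rewrite mem_head bs bx => /(_ isT).
Qed.

End Space.

(** * Existence of the space *)

Lemma free_ultrafilter : exists F : set_system nat,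
  UltraFilter F /\ forall A, F A -> infinite_set A.
Proof.
have [F [FU frF]] := ultraFilterLemma (frechet_properfilter infinite_nat).
exists F; split=> // A FA finA; apply: (@filter_not_empty _ F).
rewrite -(setICr A); apply: filterI => //; apply: frF.
by rewrite /frechet_filter /= setCK.
Qed.

Theorem theorem1p7 : CH ->
  exists X : topologicalType,
    [/\ crowded X, zero_dim X, hausdorff_space X,
        selectively_pseudocompact (@Nwd_omega X) &
        ~ selectively_pseudocompact (@Scat_omega X)].
Proof.
move=> /CH_well_order[I [lt [lt_wf lt_total lt_trans lt_ctbl I_bij]]].
have lt_irr a : ~ lt a a by elim: (lt_wf a) => {}a _ IH aa; exact: (IH a aa aa).
pose Y : choiceType := (seq bool * nat)%type.
pose X := (Y + I)%type.
have cI : continuum_bounded I by have [f [g fK _]] := I_bij; exists g => a; exists (f a).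
have cY : continuum_bounded Y by exact: (@continuum_bounded_countType (seq bool * nat)%type ([::], 0)).
have cX : continuum_bounded X by exact: continuum_bounded_sum.
have cC := continuum_bounded_prod (continuum_bounded_seq cY)
  (continuum_bounded_prod (continuum_bounded_seq cX) cX).
have [code codeP] := cofinal_coding lt_total lt_ctbl I_bij cC.
have Yinf : infinite_set [set: Y].
  by apply: (@infinite_range_subset _ _ (pair [::])) => // m n [].
(* The family separates only points of [Y]; if the coded point lies in [I], then [([::], 0)] is
   filler and [coord] does the separation. *)
have [v vP] := @independent_family I lt lt_wf lt_ctbl Y column
  (fun a => [set y | exists n, (code a).2.1 n = inl y])
  (fun a => if (code a).2.2 is inl y then y else ([::], 0)) Yinf.
have v_splits a : splits_at lt column v a (v a) by have [] := vP a.
have [F [FU Ffree]] := free_ultrafilter.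
exists (coord_space (coord lt v code F)); split.
- exact: space_crowded.
- exact: coord_space_zero_dim.
- apply: space_hausdorff => // a /(proj2 (vP a))[vS vx]; split=> // y ya nS.
  by move: vx; rewrite ya; apply.
- exact: space_Nwd.
- apply: space_not_Scat => // a /(proj2 (vP a))[vS vx]; split=> // y ya nS.
  by move: vx; rewrite ya; apply.
Qed.
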